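(* Let $G=\pi_1(X_K,x_0)$ be the group of a nontrivial tame knot $K\subset S^3$ with meridian $m\in G$, let $U\le G$ be a finite-index subgroup, let $M_U\trianglelefteq U$ be its ramification subgroup, and let $\pi:U\to U/M_U$ be the quotient map. For any prime $p$, the inflation map induces an isomorphism $$H^1(U/M_U;\mathbb F_p)\;\xrightarrow{\ \cong\ }\;\left\{\alpha\in H^1(U;\mathbb F_p)\ :\ \alpha\text{ is meridionally unramified}\right\},\qquad \beta\mapsto\beta\circ\pi .$$ Equivalently, a homomorphism $U\to\mathbb F_p$ factors through $U/M_U$ if and only if it vanishes on every inertia subgroup $U\cap g\langle m\rangle g^{-1}$, $g\in G$.
   Context: $K\subset S^3$ is a nontrivial tame knot, $\nu(K)$ is a tubular neighbourhood of $K$, $X_K=S^3\setminus\operatorname{int}(\nu(K))$ is the knot exterior, $x_0\in\partial X_K$ is a basepoint, and $G=\pi_1(X_K,x_0)$. A meridian is an element of $\pi_1(\partial X_K,x_0)$ represented by a simple closed curve on the torus $\partial X_K$ bounding an embedded disk in $\nu(K)$ that meets $K$ once; $m\in G$ denotes the image of a chosen meridian under the map induced by inclusion $\partial X_K\hookrightarrow X_K$. For a finite-index subgroup $U\le G$ and $g\in G$, the meridional inertia subgroup is $I_g(U):=U\cap g\langle m\rangle g^{-1}$. The ramification subgroup $M_U$ of $U$ is the normal closure in $U$ of $\bigcup_{g\in G}I_g(U)$, i.e. the smallest normal subgroup of $U$ containing every $I_g(U)$, $g\in G$. For a discrete group $H$, $H^1(H;\mathbb F_p)$ (trivial coefficients)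 is identified with $\mathrm{Hom}(H,\mathbb F_p)$. A class $\alpha\in H^1(U;\mathbb F_p)$ is meridionally unramified if its restriction to $H^1(U\cap g\langle m\rangle g^{-1};\mathbb F_p)$ is $0$ for every $g\in G$. *)

(* Defs.v *)
From HB Require Import structures.
From mathcomp Require Import all_boot all_order all_algebra.
From mathcomp Require Import generic_quotient.
From mathcomp Require Import mathcomp_extra boolp classical_sets functions.
From mathcomp Require Import cardinality reals topology normedtype.
From mathcomp Require Import homotopy.
From mathcomp Require Import ring lra.

Set Implicit Arguments.
Unset Strict Implicit.
Unset Printing Implicit Defensive.

Import Order.TTheory GRing.Theory Num.Theory.
Import numFieldNormedType.Exports.

Local Open Scope classical_set_scope.
Local Open Scope quotient_scope.

Local Open Scope group_scope.

HB.mixin Record isConjClosed (G : groupType) (S : {pred G}) := {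
  gpred_conj : forall x y : G, x \in S -> x ^ y \in S
}.

#[short(type="normalClosed")]
HB.structure Definition NormalClosed (G : groupType) :=
  {S of GroupClosed G S & isConjClosed G S}.

Section Subgroup.
Context (G : groupType) (U : groupClosed G).

Definition subgroup : Type := {x : G | x \in U}.

HB.instance Definition _ := SubType.on subgroup.
HB.instance Definition _ := Choice.on subgroup.

Fact subgroup_closed : group_closed U.
Proof. by split; [exact: gpred1 | move=> x y; exact: gpredF]. Qed.

HB.instance Definition _ :=
  SubChoice_isSubGroup.Build G (fun x => x \in U) subgroup subgroup_closed.

Definition left_coset (g : G) : set G := [set x | g^-1 * x \in U].

Definition finite_index := finite_set (range left_coset).

End Subgroup.

Section NormalClosure.
Context (G : groupType) (A : set G).

Definition normal_closure : {pred G} :=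
  fun x => `[< forall N : normalClosed G, A `<=` [set` N] -> x \in N >].

Lemma normal_closureP x : reflect
  (forall N : normalClosed G, A `<=` [set` N] -> x \in N)
  (x \in normal_closure).
Proof. exact: asboolP. Qed.

Fact normal_closure1 : 1 \in normal_closure.
Proof. by apply/normal_closureP => N _; exact: gpred1. Qed.

Fact normal_closureM : mulg_closed normal_closure.
Proof.
move=> x y /normal_closureP Nx /normal_closureP Ny.
by apply/normal_closureP => N AN; apply: gpredM; [exact: Nx|exact: Ny].
Qed.

Fact normal_closureV : invg_closed normal_closure.
Proof.
move=> x /normal_closureP Nx; apply/normal_closureP => N AN.
by rewrite gpredV; exact: Nx.
Qed.

Fact normal_closure_conj x y : x \in normal_closure -> x ^ y \in normal_closure.
Proof.
move=> /normal_closureP Nx; apply/normal_closureP => N AN.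
by apply: gpred_conj; exact: Nx.
Qed.

HB.instance Definition _ := isMulClosed.Build G normal_closure normal_closureM.
HB.instance Definition _ := isMul1Closed.Build G normal_closure normal_closure1.
HB.instance Definition _ := isInvClosed.Build G normal_closure normal_closureV.
HB.instance Definition _ :=
  isConjClosed.Build G normal_closure normal_closure_conj.

End NormalClosure.

Section Quotient.
Context (G : groupType) (N : normalClosed G).

Definition same_coset (x y : G) := x^-1 * y \in N.

Fact same_coset_refl : reflexive same_coset.
Proof. by move=> x; rewrite /same_coset mulVg gpred1. Qed.

Fact same_coset_sym : symmetric same_coset.
Proof. by move=> x y; rewrite /same_coset -gpredV invgM invgK. Qed.

Fact same_coset_trans : transitive same_coset.
Proof.
move=> y x z xy yz; rewrite /same_coset.
by rewrite -(mulgK y x^-1) -mulgA gpredM // -?(mulgA x^-1).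
Qed.

Canonical same_coset_equiv :=
  EquivRel same_coset same_coset_refl same_coset_sym same_coset_trans.

Definition quotient_group := {eq_quot same_coset_equiv}.

HB.instance Definition _ := Choice.on quotient_group.
HB.instance Definition _ : EqQuotient G same_coset_equiv quotient_group :=
  EqQuotient.on quotient_group.

Definition coset : G -> quotient_group := \pi_quotient_group.

Lemma cosetP x y : coset x = coset y <-> x^-1 * y \in N.
Proof. by split=> [/eqmodP//|xy]; exact/eqmodP. Qed.

Definition quotient_mul (a b : quotient_group) := coset (repr a * repr b).
Definition quotient_inv (a : quotient_group) := coset (repr a)^-1.
Definition quotient_one := coset 1.

Lemma quotient_ind (P : quotient_group -> Prop) :
  (forall x, P (coset x)) -> forall a, P a.
Proof. by move=> Px a; rewrite -[a]reprK; exact: Px. Qed.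

Lemma coset_repr x : x^-1 * repr (coset x) \in N.
Proof. by apply/cosetP; rewrite /coset reprK. Qed.

Lemma coset_mul x y : quotient_mul (coset x) (coset y) = coset (x * y).
Proof.
apply/esym/cosetP; have Nx := coset_repr x; have Ny := coset_repr y.
have -> : (x * y)^-1 * (repr (coset x) * repr (coset y)) =
  (x^-1 * repr (coset x)) ^ y * (y^-1 * repr (coset y)).
  by rewrite /conjg invgM !mulgA !mulgK.
by apply: gpredM => //; exact: gpred_conj.
Qed.

Lemma coset_inv x : quotient_inv (coset x) = coset x^-1.
Proof.
apply/cosetP; rewrite invgK; have Nx := coset_repr x.
have -> : repr (coset x) / x = (x^-1 * repr (coset x)) ^ x^-1.
  by rewrite /conjg invgK !mulgA mulgV mul1g.
exact: gpred_conj.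
Qed.

Fact quotient_mulA : associative quotient_mul.
Proof.
by do 3![elim/quotient_ind => ?]; rewrite !coset_mul mulgA.
Qed.

Fact quotient_mul1 : left_id quotient_one quotient_mul.
Proof. by elim/quotient_ind => x; rewrite coset_mul mul1g. Qed.

Fact quotient_1mul : right_id quotient_one quotient_mul.
Proof. by elim/quotient_ind => x; rewrite coset_mul mulg1. Qed.

Fact quotient_mulV : left_inverse quotient_one quotient_inv quotient_mul.
Proof. by elim/quotient_ind => x; rewrite coset_inv coset_mul mulVg. Qed.

Fact quotient_Vmul : right_inverse quotient_one quotient_inv quotient_mul.
Proof. by elim/quotient_ind => x; rewrite coset_inv coset_mul mulgV. Qed.

HB.instance Definition _ := isGroup.Build quotient_group
  quotient_mulA quotient_mul1 quotient_1mul quotient_mulV quotient_Vmul.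

Fact coset_is_multiplicative : {morph coset : x y / x * y}.
Proof. by move=> x y; exact/esym/coset_mul. Qed.

HB.instance Definition _ :=
  isMultiplicative.Build G quotient_group coset coset_is_multiplicative.

End Quotient.

Local Close Scope group_scope.

Section Cohomology.
Local Open Scope ring_scope.

Section H1.
Context (H : groupType) (F : fieldType).

Definition add_char : {pred H -> F^o} :=
  fun f => `[< forall x y : H, f (x * y)%g = f x + f y >].

Fact add_char_submod : submod_closed add_char.
Proof.
split=> [|a f g /asboolP fM /asboolP gM]; apply/asboolP => x y.
  by rewrite [RHS]addr0.
by rewrite -![(a *: f + g) _]/(a *: f _ + g _) fM gM scalerDr addrACA.
Qed.

HB.instance Definition _ := GRing.isSubmodClosed.Build F (H -> F^o) add_char
  add_char_submod.

Definition H1 : Type := {f : H -> F^o | f \in add_char}.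

HB.instance Definition _ := SubType.on H1.
HB.instance Definition _ := Choice.on H1.
HB.instance Definition _ := [SubChoice_isSubLmodule of H1 by <:].

Definition H1_fun (a : H1) : H -> F := val a.
Coercion H1_fun : H1 >-> Funclass.

Lemma H1M (a : H1) x y : a (x * y)%g = a x + a y.
Proof. by have /asboolP := valP a; exact. Qed.

End H1.

Section Functoriality.
Context (F : fieldType) (H' H : groupType) (f : {multiplicative H' -> H}).

Fact H1_map_subproof (a : H1 H F) : (a \o f : H' -> F^o) \in @add_char H' F.
Proof. by apply/asboolP => x y /=; rewrite gmulfM H1M. Qed.

Definition H1_map (a : H1 H F) : H1 H' F :=
  exist _ (a \o f : H' -> F^o) (H1_map_subproof a).

End Functoriality.
End Cohomology.


Section Ramification.
Local Open Scope group_scope.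
Context (G : groupType).

Section Cyclic.
Context (m : G).

Definition cyclic_subgroup : {pred G} :=
  fun x => `[< exists n : nat, x = m ^+ n \/ x = m ^- n >].

Lemma cyclic_subgroupP x :
  reflect (exists n : nat, x = m ^+ n \/ x = m ^- n) (x \in cyclic_subgroup).
Proof. exact: asboolP. Qed.

Fact cyclic_subgroup1 : 1 \in cyclic_subgroup.
Proof. by apply/cyclic_subgroupP; exists 0%N; left; rewrite expg0. Qed.

Fact cyclic_subgroupV : invg_closed cyclic_subgroup.
Proof.
move=> x /cyclic_subgroupP[n [->|->]]; apply/cyclic_subgroupP; exists n;
  [by right|by left; rewrite invgK].
Qed.

Lemma cyclic_subgroup_expgF a b : m ^+ a / m ^+ b \in cyclic_subgroup.
Proof.
have [ab|/ltnW ba] := leqP b a; apply/cyclic_subgroupP.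
  by exists (a - b)%N; left; rewrite -{1}(subnK ab) expgnDr mulgK.
exists (b - a)%N; right.
by rewrite -{1}(subnK ba) expgnDr invgM mulgA mulgV mul1g.
Qed.

Fact cyclic_subgroupM : mulg_closed cyclic_subgroup.
Proof.
move=> x y /cyclic_subgroupP[a xa] /cyclic_subgroupP[b yb].
case: xa yb => [->|->] [->|->].
- by apply/cyclic_subgroupP; exists (a + b)%N; left; rewrite expgnDr.
- exact: cyclic_subgroup_expgF.
- have -> : m ^- a * m ^+ b = m ^+ b / m ^+ a.
    have ab : commute (m ^+ a) (m ^+ b) by exact/commuteX2/commute_refl.
    by apply: (canRL (mulgK _)); rewrite -mulgA -ab mulgA mulVg mul1g.
  by rewrite -[_ * _]invgK; apply: cyclic_subgroupV; rewrite invgM invgK;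
    exact: cyclic_subgroup_expgF.
- by apply/cyclic_subgroupP; exists (b + a)%N; right; rewrite expgnDr invgM.
Qed.

HB.instance Definition _ :=
  isMulClosed.Build G cyclic_subgroup cyclic_subgroupM.
HB.instance Definition _ :=
  isMul1Closed.Build G cyclic_subgroup cyclic_subgroup1.
HB.instance Definition _ :=
  isInvClosed.Build G cyclic_subgroup cyclic_subgroupV.

End Cyclic.

Section Inertia.
Context (m : G) (U : groupClosed G) (g : G).

Definition inertia : {pred subgroup U} :=
  fun u => `[< exists2 c, c \in cyclic_subgroup m & val u = g * c * g^-1 >].

Lemma inertiaE u : (u \in inertia) = (val u ^ g \in cyclic_subgroup m).
Proof.
apply/asboolP/idP => [[c mc ->]|mu].
  by rewrite /conjg !mulgA mulVg mul1g -mulgA mulVg mulg1.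
by exists (val u ^ g) => //; rewrite /conjg !mulgA mulgV mul1g mulgK.
Qed.

Fact inertia1 : 1 \in inertia.
Proof. by rewrite inertiaE conj1g gpred1. Qed.

Fact inertiaM : mulg_closed inertia.
Proof.
by move=> x y; rewrite !inertiaE conjMg => mx my; exact: gpredM.
Qed.

Fact inertiaV : invg_closed inertia.
Proof. by move=> x; rewrite !inertiaE conjVg gpredV. Qed.

HB.instance Definition _ := isMulClosed.Build _ inertia inertiaM.
HB.instance Definition _ := isMul1Closed.Build _ inertia inertia1.
HB.instance Definition _ := isInvClosed.Build _ inertia inertiaV.

End Inertia.

Arguments inertia : clear implicits.

Definition ramification_subgroup (m : G) (U : groupClosed G) :
    {pred subgroup U} :=
  normal_closure (\bigcup_(g in [set: G]) [set` inertia m U g]).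

Arguments ramification_subgroup : clear implicits.

HB.instance Definition _ (m : G) (U : groupClosed G) :=
  NormalClosed.on (ramification_subgroup m U).

Definition unramified (F : fieldType) (m : G) (U : groupClosed G)
    (a : H1 (subgroup U) F) :=
  forall g : G,
    H1_map (val : subgroup (inertia m U g) -> subgroup U) a = 0%R.

Definition inflation (F : fieldType) (H : groupType) (N : normalClosed H) :
  H1 (quotient_group N) F -> H1 H F := H1_map (@coset H N).

End Ramification.

Arguments inertia {G}.
Arguments ramification_subgroup {G}.
Arguments inflation F {H} N.
Arguments coset {G} N.

Section Continuity.
Context {X Y Z : topologicalType}.

Lemma comp_continuous (f : X -> Y) (g : Y -> Z) :
  continuous f -> continuous g -> continuous (fun x => g (f x)).
Proof. by move=> cf cg x; exact: continuous_comp (cf x) (cg (f x)). Qed.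

Lemma pair_continuous (f : X -> Y) (g : X -> Z) :
  continuous f -> continuous g -> continuous (fun x => (f x, g x)).
Proof. by move=> cf cg x; apply: cvg_pair; [exact: cf|exact: cg]. Qed.

Lemma fst_continuous : continuous (@fst X Y).
Proof. by move=> x; exact: cvg_fst. Qed.

Lemma snd_continuous : continuous (@snd X Y).
Proof. by move=> x; exact: cvg_snd. Qed.

End Continuity.

Section UnitInterval.
Local Open Scope ring_scope.
Context (R : realType).

Definition unit_interval : Type := set_type (`[0, 1]%classic : set R).

HB.instance Definition _ :=
  Topological.copy unit_interval (set_type (`[0, 1]%classic : set R)).

Implicit Types (t : unit_interval) (r : R).

Definition coord t : R := val t.

Lemma coord_itv t : 0 <= coord t <= 1.
Proof. by rewrite /coord; case: t => r /= /set_mem; rewrite /= in_itv. Qed.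

Fact clamp_subproof r : Num.max 0 (Num.min 1 r) \in (`[0, 1]%classic : set R).
Proof.
by apply/mem_set; rewrite /= in_itv /= le_max lexx /= ge_max ler01 ge_min lexx.
Qed.

Definition clamp r : unit_interval := SigSub (clamp_subproof r).

Lemma clampE r : coord (clamp r) = Num.max 0 (Num.min 1 r).
Proof. by []. Qed.

Lemma clampK r : 0 <= r <= 1 -> coord (clamp r) = r.
Proof. by rewrite clampE => /andP[r0 r1]; rewrite min_r // max_r. Qed.

Lemma coord_inj : injective coord. Proof. exact: val_inj. Qed.

Lemma coordK t : clamp (coord t) = t.
Proof. by apply: coord_inj; rewrite clampK ?coord_itv. Qed.

Lemma clamp_le0 r : r <= 0 -> clamp r = clamp 0.
Proof.
move=> r0; apply: coord_inj; rewrite [RHS]clampK ?lexx ?ler01 // clampE.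
by rewrite min_r ?max_l // (le_trans r0).
Qed.

Lemma clamp_ge1 r : 1 <= r -> clamp r = clamp 1.
Proof.
move=> r1; apply: coord_inj; rewrite [RHS]clampK ?lexx ?ler01 // clampE.
by rewrite min_l // max_r.
Qed.

Fact clamp01 : clamp 0 != clamp 1.
Proof.
apply/eqP => /(congr1 coord); rewrite !clampK ?lexx ?ler01 // => /eqP.
by rewrite eq_sym oner_eq0.
Qed.

HB.instance Definition _ := isBiPointed.Build unit_interval clamp01.

Lemma coord0 : coord zero = 0. Proof. by rewrite clampK ?lexx ?ler01. Qed.
Lemma coord1 : coord one = 1. Proof. by rewrite clampK ?lexx ?ler01. Qed.

Lemma coord_continuous : continuous coord.
Proof. exact: initial_continuous. Qed.

Lemma clamp_continuous : continuous clamp.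
Proof.
apply: continuous_comp_initial => r.
apply: (@continuous_max R R (cst 0) (fun r => Num.min 1 r)); first exact: cvg_cst.
by apply: (@continuous_min R R (cst 1) id); [exact: cvg_cst|exact: cvg_id].
Qed.

Lemma clamp_comp_continuous (X : topologicalType) (f : X -> R) :
  continuous f -> continuous (fun x => clamp (f x)).
Proof. by move=> cf; exact: (@comp_continuous _ R _ f clamp cf clamp_continuous). Qed.

Lemma coord_comp_continuous (X : topologicalType) (f : X -> unit_interval) :
  continuous f -> continuous (fun x => coord (f x)).
Proof. by move=> cf; exact: (@comp_continuous _ _ R f coord cf coord_continuous). Qed.

Lemma scale_coord_continuous (a : R) : continuous (fun t => a * coord t).
Proof.
by move=> t; apply: (@cvgM _ unit_interval (nbhs t) _ (cst a) coord); [exact: cvg_cst|exact: coord_continuous].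
Qed.

Lemma affine_coord_continuous (a b : R) : continuous (fun t => a * coord t + b).
Proof.
move=> t; apply: (@cvgD _ _ unit_interval (nbhs t) _ (fun t => a * coord t) (cst b));
  [exact: scale_coord_continuous|exact: cvg_cst].
Qed.

Lemma onem_coord_continuous : continuous (fun t => 1 - coord t).
Proof.
rewrite [X in continuous X](_ : _ = fun t => -1 * coord t + 1).
  exact: affine_coord_continuous.
by apply/funext => t; rewrite mulN1r addrC.
Qed.

Lemma glue_continuous (X T : topologicalType) (u : X -> R) (c : R)
    (f g : X -> T) :
  continuous u -> continuous f -> continuous g ->
  (forall x, u x = c -> f x = g x) ->
  continuous (fun x => if u x <= c then f x else g x).
Proof.
move=> cu /continuous_closedP cf /continuous_closedP cg fg.
apply/continuous_closedP => C cC.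
rewrite [X in closed X](_ : _ =
  (f @^-1` C `&` u @^-1` [set r | r <= c]) `|`
  (g @^-1` C `&` u @^-1` [set r | c <= r])).
  move/continuous_closedP: cu => cu; apply: closedU; apply: closedI.
  - exact: cf.
  - by apply: cu; exact: closed_le.
  - exact: cg.
  - by apply: cu; exact: closed_ge.
apply/seteqP; split=> x /=.
  by case: (lerP (u x) c) => [|/ltW]; [left|right].
case=> -[Cx ux]; first by rewrite ux.
case: ifPn => // xc; rewrite fg //; lra.
Qed.

End UnitInterval.

Arguments clamp {R} r.
Arguments coord {R} t.

Section FundamentalGroup.
Local Open Scope ring_scope.
Context (R : realType).
Local Notation I := (unit_interval R).

Section PathHomotopy.
Context (T : topologicalType) (x y : T).
Implicit Types f g h : {path I from x to y}.

Definition path_homotopic f g := exists H : I * I -> T,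
  [/\ continuous H,
      forall t, H (zero, t) = f t,
      forall t, H (one, t) = g t,
      forall s, H (s, zero) = x &
      forall s, H (s, one) = y].

Lemma affine_homotopy f g (k : I -> T) (a b : I -> R) :
    continuous k -> continuous a -> continuous b ->
    a zero = b zero -> a one = b one ->
    f =1 k \o clamp \o a -> g =1 k \o clamp \o b ->
  path_homotopic f g.
Proof.
move=> ck ca cb ab0 ab1 fE gE.
exists (fun st => k (clamp ((1 - coord st.1) * a st.2 + coord st.1 * b st.2))).
split.
- apply: (comp_continuous _ ck); apply: clamp_comp_continuous.
  have cs : continuous (fun st : I * I => coord st.1).
    exact: coord_comp_continuous fst_continuous.
  have c2 (c : I -> R) : continuous c -> continuous (fun st : I * I => c st.2).
    by move=> cc; exact: (@comp_continuous _ I R snd c snd_continuous).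
  move=> st; apply: cvgD; apply: cvgM.
  + by apply: cvgB; [exact: cvg_cst|exact: cs].
  + exact: c2.
  + exact: cs.
  + exact: c2.
- by move=> t; rewrite coord0 subr0 mul1r mul0r addr0 fE.
- by move=> t; rewrite coord1 subrr mul1r mul0r add0r gE.
- move=> s; rewrite -ab0 -mulrDl subrK mul1r; rewrite -[LHS]fE; exact: path_zero.
- move=> s; rewrite -ab1 -mulrDl subrK mul1r; rewrite -[LHS]fE; exact: path_one.
Qed.

Lemma path_homotopic_eq f g : f =1 g -> path_homotopic f g.
Proof.
move=> fg; apply: (@affine_homotopy f g f coord coord) => //.
- exact: cts_fun.
- exact: coord_continuous.
- exact: coord_continuous.
- by move=> t /=; rewrite coordK.
- by move=> t /=; rewrite coordK fg.
Qed.

Lemma path_homotopic_sym f g : path_homotopic f g -> path_homotopic g f.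
Proof.
case=> H [cH H0 H1 Hx Hy].
exists (fun st => H (clamp (1 - coord st.1), st.2)); split=> //=.
- apply: (comp_continuous _ cH); apply: (pair_continuous _ snd_continuous).
  apply: clamp_comp_continuous => st.
  apply: cvgB; first exact: cvg_cst.
  exact: (coord_comp_continuous fst_continuous).
- by move=> t; rewrite coord0 subr0 H1.
- by move=> t; rewrite coord1 subrr H0.
Qed.

Lemma path_homotopic_trans g f h :
  path_homotopic f g -> path_homotopic g h -> path_homotopic f h.
Proof.
move=> [H [cH H0 H1 Hx Hy]] [K [cK K0 K1 Kx Ky]].
exists (fun st => if coord st.1 <= 2^-1 then H (clamp (2 * coord st.1), st.2)
  else K (clamp (2 * coord st.1 - 1), st.2)); split=> /=.
- have cs : continuous (fun st : I * I => coord st.1).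
    exact: coord_comp_continuous fst_continuous.
  apply: (@glue_continuous R (I * I)%type T (fun st => coord st.1) 2^-1
    (fun st => H (clamp (2 * coord st.1), st.2))
    (fun st => K (clamp (2 * coord st.1 - 1), st.2))) => //.
  + apply: (comp_continuous _ cH); apply: (pair_continuous _ snd_continuous).
    apply: clamp_comp_continuous => st.
    by apply: cvgM; [exact: cvg_cst|exact: cs].
  + apply: (comp_continuous _ cK); apply: (pair_continuous _ snd_continuous).
    apply: clamp_comp_continuous => st.
    apply: cvgB; last exact: cvg_cst.
    by apply: cvgM; [exact: cvg_cst|exact: cs].
  + move=> [s t] /= ->; rewrite mulfV ?pnatr_eq0 // subrr.
    by rewrite H1 K0.
- by move=> t; rewrite coord0 invr_ge0 ler0n mulr0 H0.
- move=> t; rewrite coord1 ifF; last by apply/negP; lra.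
  by rewrite (_ : 2 * 1 - 1 = 1) ?K1 //; lra.
- by move=> s; case: ifP.
- by move=> s; case: ifP.
Qed.

End PathHomotopy.

Section PathOperations.
Context (T : topologicalType).

Section Concatenation.
Context (x y z : T) (f : {path I from x to y}) (g : {path I from y to z}).

Definition concat_fun (t : I) : T :=
  if coord t <= 2^-1 then f (clamp (2 * coord t))
  else g (clamp (2 * coord t - 1)).

Fact concat_continuous : continuous concat_fun.
Proof.
apply: (@glue_continuous R I T coord 2^-1 (fun t => f (clamp (2 * coord t)))
  (fun t => g (clamp (2 * coord t - 1)))).
- exact: coord_continuous.
- apply: (comp_continuous _ (@cts_fun _ _ _)).
  apply: clamp_comp_continuous ; exact: scale_coord_continuous.
- apply: (comp_continuous _ (@cts_fun _ _ _)).
  apply: clamp_comp_continuous ; exact: affine_coord_continuous.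
- move=> t ->; rewrite mulfV ?pnatr_eq0 // subrr.
  by rewrite [LHS](path_one (s := f)) [RHS](path_zero (s := g)).
Qed.

Fact concat_zero : concat_fun zero = x.
Proof. by rewrite /concat_fun coord0 invr_ge0 ler0n mulr0; exact: path_zero. Qed.

Fact concat_one : concat_fun one = z.
Proof.
rewrite /concat_fun coord1 ifF; last by apply/negP; lra.
by rewrite (_ : 2 * 1 - 1 = 1); [exact: path_one|lra].
Qed.

Definition concat : {path I from x to z} :=
  mk_path concat_continuous concat_zero concat_one.

End Concatenation.

Section Reversal.
Context (x y : T) (f : {path I from x to y}).

Definition reverse_fun (t : I) : T := f (clamp (1 - coord t)).

Fact reverse_continuous : continuous reverse_fun.
Proof.
apply: (comp_continuous _ (@cts_fun _ _ _)).
apply: clamp_comp_continuous ; exact: onem_coord_continuous.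
Qed.

Fact reverse_zero : reverse_fun zero = y.
Proof. by rewrite /reverse_fun coord0 subr0; exact: path_one. Qed.

Fact reverse_one : reverse_fun one = x.
Proof. by rewrite /reverse_fun coord1 subrr; exact: path_zero. Qed.

Definition reverse : {path I from y to x} :=
  mk_path reverse_continuous reverse_zero reverse_one.

End Reversal.
End PathOperations.

Arguments concat : simpl never.
Arguments reverse : simpl never.

Section PathAlgebra.
Context (T : topologicalType).

Lemma concat_homotopic (x y z : T) (f f' : {path I from x to y})
    (g g' : {path I from y to z}) :
  path_homotopic f f' -> path_homotopic g g' ->
  path_homotopic (concat f g) (concat f' g').
Proof.
move=> [H [cH H0 H1 Hx Hy]] [K [cK K0 K1 Kx Ky]].
exists (fun st => if coord st.2 <= 2^-1 then H (st.1, clamp (2 * coord st.2))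
  else K (st.1, clamp (2 * coord st.2 - 1))); split=> /=.
- apply: (@glue_continuous R (I * I)%type T (fun st => coord st.2) 2^-1
    (fun st => H (st.1, clamp (2 * coord st.2)))
    (fun st => K (st.1, clamp (2 * coord st.2 - 1)))).
  + exact: coord_comp_continuous snd_continuous.
  + apply: (comp_continuous _ cH); apply: (pair_continuous fst_continuous).
    apply: clamp_comp_continuous.
    exact: (@comp_continuous _ I R snd (fun t => 2 * coord t) snd_continuous
      (@scale_coord_continuous R 2)).
  + apply: (comp_continuous _ cK); apply: (pair_continuous fst_continuous).
    apply: clamp_comp_continuous.
    exact: (@comp_continuous _ I R snd (fun t => 2 * coord t - 1) snd_continuous
      (@affine_coord_continuous R 2 (-1))).
  + move=> [s t] /= ->; rewrite mulfV ?pnatr_eq0 // subrr.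
    by rewrite [LHS]Hy [RHS]Kx.
- by move=> t; rewrite H0 K0.
- by move=> t; rewrite H1 K1.
- by move=> s; rewrite coord0 invr_ge0 ler0n mulr0; exact: Hx.
- move=> s; rewrite coord1 ifF; last by apply/negP; lra.
  by rewrite (_ : 2 * 1 - 1 = 1); [exact: Ky|lra].
Qed.

Lemma reverse_homotopic (x y : T) (f f' : {path I from x to y}) :
  path_homotopic f f' -> path_homotopic (reverse f) (reverse f').
Proof.
move=> [H [cH H0 H1 Hx Hy]].
exists (fun st => H (st.1, clamp (1 - coord st.2))); split=> /=.
- apply: (comp_continuous _ cH); apply: (pair_continuous fst_continuous).
  apply: clamp_comp_continuous.
  exact: (@comp_continuous _ I R snd (fun t => 1 - coord t) snd_continuous
      (@onem_coord_continuous R)).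
- by move=> t; rewrite H0.
- by move=> t; rewrite H1.
- by move=> s; rewrite coord0 subr0; exact: Hy.
- by move=> s; rewrite coord1 subrr; exact: Hx.
Qed.

Lemma concat_lel (x y z : T) (f : {path I from x to y})
    (g : {path I from y to z}) (r : R) :
  0 <= r <= 2^-1 -> concat f g (clamp r) = f (clamp (2 * r)).
Proof.
move=> /andP[r0 r1]; rewrite -[LHS]/(concat_fun f g (clamp r)) /concat_fun clampK; last by lra.
by rewrite r1.
Qed.

Lemma concat_gtr (x y z : T) (f : {path I from x to y})
    (g : {path I from y to z}) (r : R) :
  2^-1 < r <= 1 -> concat f g (clamp r) = g (clamp (2 * r - 1)).
Proof.
move=> /andP[r0 r1]; rewrite -[LHS]/(concat_fun f g (clamp r)) /concat_fun clampK; last by lra.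
by rewrite leNgt r0.
Qed.

Lemma concatA (x y z w : T) (f : {path I from x to y})
    (g : {path I from y to z}) (h : {path I from z to w}) :
  path_homotopic (concat (concat f g) h) (concat f (concat g h)).
Proof.
pose phi (t : I) := if coord t <= 2^-1
  then if coord t <= 4^-1 then 2 * coord t else 1 * coord t + 4^-1
  else 2^-1 * coord t + 2^-1.
apply: (@affine_homotopy T x w _ _ (concat f (concat g h)) phi coord).
- exact: cts_fun.
- apply: (@glue_continuous R I R coord 2^-1 (fun t => if coord t <= 4^-1
    then 2 * coord t else 1 * coord t + 4^-1)
    (fun t => 2^-1 * coord t + 2^-1)).
  + exact: coord_continuous.
  + apply: (@glue_continuous R I R coord 4^-1 (fun t => 2 * coord t)
      (fun t => 1 * coord t + 4^-1)).
    * exact: coord_continuous.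
    * exact: scale_coord_continuous.
    * exact: affine_coord_continuous.
    * by move=> t ->; lra.
  + exact: affine_coord_continuous.
  + by move=> t ->; case: ifPn => ?; lra.
- exact: coord_continuous.
- by rewrite /phi coord0; case: ifPn; [case: ifPn => ?|] => ?; lra.
- by rewrite /phi coord1; case: ifPn; [case: ifPn => ?|] => ?; lra.
- move=> t /=; have t01 := coord_itv t.
  rewrite -[X in concat _ _ X = _]coordK /phi.
  case: (leP (coord t) 2^-1) => t2.
    rewrite concat_lel; last by lra.
    case: (leP (coord t) 4^-1) => t4.
      rewrite concat_lel; last by lra.
      by rewrite [RHS]concat_lel //; lra.
    rewrite concat_gtr; last by lra.
    rewrite [RHS]concat_gtr; last by lra.
    rewrite concat_lel; last by lra.
    by congr (g (clamp _)); lra.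
  rewrite concat_gtr; last by lra.
  rewrite [RHS]concat_gtr; last by lra.
  rewrite concat_gtr; last by lra.
  by congr (h (clamp _)); lra.
- by move=> t /=; rewrite coordK.
Qed.

Definition const_path (x : T) : {path I from x to x} := cst x.

Lemma concat_constl (x y : T) (f : {path I from x to y}) :
  path_homotopic (concat (const_path x) f) f.
Proof.
apply: (@affine_homotopy T x y _ _ f
  (fun t => if coord t <= 2^-1 then 0 else 2 * coord t - 1) coord).
- exact: cts_fun.
- apply: (@glue_continuous R I R coord 2^-1 (fun=> 0)
    (fun t => 2 * coord t - 1)).
  + exact: coord_continuous.
  + exact: cst_continuous.
  + exact: affine_coord_continuous.
  + by move=> t ->; lra.
- exact: coord_continuous.
- by rewrite coord0; case: ifPn => ?; lra.
- by rewrite coord1; case: ifPn => ?; lra.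
- move=> t /=; have t01 := coord_itv t.
  rewrite -[X in concat _ _ X = _]coordK.
  case: (leP (coord t) 2^-1) => t2.
    by rewrite concat_lel; [exact/esym/path_zero|lra].
  by rewrite concat_gtr //; lra.
- by move=> t /=; rewrite coordK.
Qed.

Lemma concat_constr (x y : T) (f : {path I from x to y}) :
  path_homotopic (concat f (const_path y)) f.
Proof.
apply: (@affine_homotopy T x y _ _ f
  (fun t => if coord t <= 2^-1 then 2 * coord t else 1) coord).
- exact: cts_fun.
- apply: (@glue_continuous R I R coord 2^-1 (fun t => 2 * coord t) (fun=> 1)).
  + exact: coord_continuous.
  + exact: scale_coord_continuous.
  + exact: cst_continuous.
  + by move=> t ->; lra.
- exact: coord_continuous.
- by rewrite coord0; case: ifPn => ?; lra.
- by rewrite coord1; case: ifPn => ?; lra.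
- move=> t /=; have t01 := coord_itv t.
  rewrite -[X in concat _ _ X = _]coordK.
  case: (leP (coord t) 2^-1) => t2; first by rewrite concat_lel //; lra.
  by rewrite concat_gtr; [exact/esym/path_one|lra].
- by move=> t /=; rewrite coordK.
Qed.

Lemma concat_reversel (x y : T) (f : {path I from x to y}) :
  path_homotopic (concat (reverse f) f) (const_path y).
Proof.
apply: (@affine_homotopy T y y _ _ f
  (fun t => if coord t <= 2^-1 then -2 * coord t + 1 else 2 * coord t - 1)
  (fun=> 1)).
- exact: cts_fun.
- apply: (@glue_continuous R I R coord 2^-1 (fun t => -2 * coord t + 1)
    (fun t => 2 * coord t - 1)).
  + exact: coord_continuous.
  + exact: affine_coord_continuous.
  + exact: affine_coord_continuous.
  + by move=> t ->; lra.
- exact: cst_continuous.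
- by rewrite coord0; case: ifPn => ?; lra.
- by rewrite coord1; case: ifPn => ?; lra.
- move=> t /=; have t01 := coord_itv t.
  rewrite -[X in concat _ _ X = _]coordK.
  case: (leP (coord t) 2^-1) => t2; last by rewrite concat_gtr //; lra.
  rewrite concat_lel; last by lra.
  rewrite -[LHS]/(reverse_fun f (clamp _)) /reverse_fun clampK; last by lra.
  by congr (f (clamp _)); lra.
- by move=> t /=; exact/esym/path_one.
Qed.

Lemma concat_reverser (x y : T) (f : {path I from x to y}) :
  path_homotopic (concat f (reverse f)) (const_path x).
Proof.
apply: (@affine_homotopy T x x _ _ f
  (fun t => if coord t <= 2^-1 then 2 * coord t else -2 * coord t + 2)
  (fun=> 0)).
- exact: cts_fun.
- apply: (@glue_continuous R I R coord 2^-1 (fun t => 2 * coord t)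
    (fun t => -2 * coord t + 2)).
  + exact: coord_continuous.
  + exact: scale_coord_continuous.
  + exact: affine_coord_continuous.
  + by move=> t ->; lra.
- exact: cst_continuous.
- by rewrite coord0; case: ifPn => ?; lra.
- by rewrite coord1; case: ifPn => ?; lra.
- move=> t /=; have t01 := coord_itv t.
  rewrite -[X in concat _ _ X = _]coordK.
  case: (leP (coord t) 2^-1) => t2; first by rewrite concat_lel //; lra.
  rewrite concat_gtr; last by lra.
  rewrite -[LHS]/(reverse_fun f (clamp _)) /reverse_fun clampK; last by lra.
  by congr (f (clamp _)); lra.
- by move=> t /=; exact/esym/path_zero.
Qed.

End PathAlgebra.

Section Pi1.
Context (T : topologicalType) (x : T).
Notation loop := {path I from x to x}.

Definition loop_homotopic (f g : loop) : bool := `[< path_homotopic f g >].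

Fact loop_homotopic_refl : reflexive loop_homotopic.
Proof. by move=> f; apply/asboolP; exact: path_homotopic_eq. Qed.

Fact loop_homotopic_sym : symmetric loop_homotopic.
Proof.
by move=> f g; apply/asboolP/asboolP; exact: path_homotopic_sym.
Qed.

Fact loop_homotopic_trans : transitive loop_homotopic.
Proof.
move=> g f h /asboolP fg /asboolP gh.
by apply/asboolP; exact: path_homotopic_trans fg gh.
Qed.

Canonical loop_homotopic_equiv := EquivRel loop_homotopic
  loop_homotopic_refl loop_homotopic_sym loop_homotopic_trans.

Definition pi1 := {eq_quot loop_homotopic_equiv}.

HB.instance Definition _ := Choice.on pi1.
HB.instance Definition _ : EqQuotient loop loop_homotopic_equiv pi1 :=
  EqQuotient.on pi1.

Definition loop_class : loop -> pi1 := \pi_pi1.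

Lemma loop_classP f g : loop_class f = loop_class g <-> path_homotopic f g.
Proof. by split=> [/eqmodP/asboolP//|fg]; apply/eqmodP/asboolP. Qed.

Lemma pi1_ind (P : pi1 -> Prop) :
  (forall f, P (loop_class f)) -> forall a, P a.
Proof. by move=> Pf a; rewrite -[a]reprK; exact: Pf. Qed.

Lemma repr_loop_class f : path_homotopic (repr (loop_class f)) f.
Proof. by apply/loop_classP; rewrite /loop_class reprK. Qed.

Definition pi1_mul (a b : pi1) := loop_class (concat (repr a) (repr b)).
Definition pi1_inv (a : pi1) := loop_class (reverse (repr a)).
Definition pi1_one := loop_class (const_path x).

Lemma loop_class_mul f g :
  pi1_mul (loop_class f) (loop_class g) = loop_class (concat f g).
Proof.
by apply/loop_classP; apply: concat_homotopic; exact: repr_loop_class.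
Qed.

Lemma loop_class_inv f : pi1_inv (loop_class f) = loop_class (reverse f).
Proof.
by apply/loop_classP; apply: reverse_homotopic; exact: repr_loop_class.
Qed.

Fact pi1_mulA : associative pi1_mul.
Proof.
elim/pi1_ind => f; elim/pi1_ind => g; elim/pi1_ind => h.
rewrite !loop_class_mul; apply/loop_classP.
exact/path_homotopic_sym/concatA.
Qed.

Fact pi1_mul1 : left_id pi1_one pi1_mul.
Proof.
elim/pi1_ind => f; rewrite loop_class_mul; apply/loop_classP.
exact: concat_constl.
Qed.

Fact pi1_1mul : right_id pi1_one pi1_mul.
Proof.
elim/pi1_ind => f; rewrite loop_class_mul; apply/loop_classP.
exact: concat_constr.
Qed.

Fact pi1_mulV : left_inverse pi1_one pi1_inv pi1_mul.
Proof.
elim/pi1_ind => f; rewrite loop_class_inv loop_class_mul; apply/loop_classP.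
exact: concat_reversel.
Qed.

Fact pi1_Vmul : right_inverse pi1_one pi1_inv pi1_mul.
Proof.
elim/pi1_ind => f; rewrite loop_class_inv loop_class_mul; apply/loop_classP.
exact: concat_reverser.
Qed.

HB.instance Definition _ := isGroup.Build pi1
  pi1_mulA pi1_mul1 pi1_1mul pi1_mulV pi1_Vmul.

End Pi1.

Section Pi1Map.
Context (T U : topologicalType) (f : continuousType T U) (x : T).

Definition pi1_map (a : pi1 x) : pi1 (f x) :=
  loop_class (f \o repr a : {path I from f x to f x}).

Lemma pi1_mapE (g : {path I from x to x}) :
  pi1_map (loop_class g) = loop_class (f \o g : {path I from f x to f x}).
Proof.
apply/loop_classP; have [H [cH H0 H1 Hx Hy]] := repr_loop_class g.
exists (f \o H); split=> /= [|t|t|s|s]; rewrite ?H0 ?H1 ?Hx ?Hy //.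
exact: comp_continuous cH (@cts_fun _ _ f).
Qed.

End Pi1Map.
End FundamentalGroup.

Arguments pi1 R {T} x.
Arguments loop_class {R T x} _.
Arguments pi1_map {R T U} f {x} a.

Section TopologicalMaps.
Context {X Y : topologicalType}.

Definition embedding (f : X -> Y) :=
  [/\ continuous f, injective f &
      forall A : set X, open A -> exists2 B : set Y, open B & f @^-1` B = A].

Definition homeomorphism (f : X -> Y) :=
  exists g : Y -> X, [/\ continuous f, continuous g, cancel f g & cancel g f].

End TopologicalMaps.

Section Inclusion.
Context {X : topologicalType} (A B : set X) (AB : A `<=` B).

Fact inclusion_subproof (x : A) : val x \in B.
Proof. by apply/mem_set/AB/set_mem/valP. Qed.

Definition inclusion (x : A) : B := SigSub (inclusion_subproof x).

Fact inclusion_continuous : continuous inclusion.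
Proof.
apply: continuous_comp_initial.
exact: (@initial_continuous (set_type A) X set_val).
Qed.

HB.instance Definition _ :=
  isContinuous.Build (set_type A) (set_type B) inclusion inclusion_continuous.

End Inclusion.

Section Knots.
Local Open Scope ring_scope.
Context (R : realType).

Definition sqnorm n (v : 'rV[R]_n) : R := \sum_(i < n) v 0 i ^+ 2.

Definition sphere n : set 'rV[R]_n.+1 := [set v | sqnorm v = 1].

Definition disk (r : R) : set 'rV[R]_2 := [set v | sqnorm v <= r ^+ 2].

Definition segment n (a b : 'rV[R]_n) : set 'rV[R]_n :=
  [set (1 - t) *: a + t *: b | t in `[0, 1]%classic].

Arguments sphere : clear implicits.
Arguments disk : clear implicits.

Implicit Types K N P : set (sphere 3).

Definition knot K := exists2 f : sphere 1 -> sphere 3, embedding f & range f = K.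

Definition ambient_isotopic K P :=
  exists H : unit_interval R * sphere 3 -> sphere 3,
    [/\ continuous H,
        forall t, homeomorphism (fun x => H (t, x)),
        forall x, H (zero, x) = x &
        (fun x => H (one, x)) @` K = P].

(* Projection of the sphere from the pole (0, 0, 0, 1) onto the first three
   coordinates; the value at the pole is irrelevant. *)
Definition stereographic (x : sphere 3) : 'rV[R]_3 :=
  \row_(i < 3) (val x 0 (lift ord_max i) / (1 - val x 0 ord_max)).

(* A finite union of straight segments of R^3, R^3 being seen as the
   complement of the pole. *)
Definition polygonal P := exists s : seq ('rV[R]_3 * 'rV[R]_3),
  P = [set x : sphere 3 | val x 0 ord_max != 1 /\
               exists2 e, e \in s & segment e.1 e.2 (stereographic x)].

Definition tame_knot K := knot K /\
  exists P, [/\ knot P, polygonal P & ambient_isotopic K P].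

Definition great_circle : set (sphere 3) :=
  [set x : sphere 3 | forall i : 'I_4, (2 <= i)%N -> val x 0 i = 0].

Definition trivial_knot K := ambient_isotopic K great_circle.

(* N is the image of S^1 x D^2, with core K. The parametrization is required to
   extend to a thicker solid torus so that the boundary torus of N is not wild:
   an embedding of S^1 x D^2 alone would not ensure this. *)
Definition tubular_neighbourhood K N :=
  exists f : sphere 1 * disk 2 -> sphere 3,
    [/\ embedding f,
        f @` [set z : sphere 1 * disk 2 | val z.2 = 0] = K &
        f @` [set z : sphere 1 * disk 2 | disk 1 (val z.2)] = N].

Definition exterior N : set (sphere 3) := ~` N^°.

(* The boundary of the exterior, which is the frontier of N. *)
Definition exterior_boundary N : set (sphere 3) := N `\` N^°.

Lemma exterior_boundary_sub N : exterior_boundary N `<=` exterior N.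
Proof. by move=> x []. Qed.

Definition boundary_inclusion N : exterior_boundary N -> exterior N :=
  inclusion (@exterior_boundary_sub N).

HB.instance Definition _ N := Continuous.on (boundary_inclusion (N := N)).

Definition knot_group N (x0 : exterior_boundary N) : groupType :=
  pi1 R (boundary_inclusion x0).

Definition peripheral_map N (x0 : exterior_boundary N) :
    pi1 R x0 -> knot_group x0 :=
  pi1_map (boundary_inclusion (N := N)).

Definition simple_loop (T : topologicalType) (x : T)
    (f : {path unit_interval R from x to x}) :=
  forall s t, f s = f t ->
    [\/ s = t, s = zero /\ t = one | s = one /\ t = zero].

(* In a chart around p, K is the third coordinate axis and D is the plane of the
   first two coordinates. *)
Definition transverse_at K (D : set (sphere 3)) (p : sphere 3) :=
  exists f : 'rV[R]_3 -> sphere 3,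
    [/\ embedding f, open (range f), f 0 = p,
        f @^-1` K = [set v | forall i : 'I_3, i != ord_max -> v 0 i = 0] &
        f @^-1` D = [set v | v 0 ord_max = 0]].

(* Transversality is part of "meeting K once": a disk merely touching K at one
   point could have a boundary curve that is inessential in the torus. *)
Definition meets_once K (D : set (sphere 3)) :=
  exists2 p, K `&` D = [set p] & transverse_at K D p.

Definition meridian K N (x0 : exterior_boundary N) (a : pi1 R x0) :=
  exists (f : {path unit_interval R from x0 to x0}) (d : disk 1 -> sphere 3),
    [/\ loop_class f = a /\ simple_loop f,
        embedding d,
        range d `<=` N,
        d @` [set z : disk 1 | sqnorm (val z) = 1] = range (fun t => val (f t)) &
        meets_once K (range d)].

End Knots.

Arguments sphere : clear implicits.
Arguments disk : clear implicits.

(* Main.v *)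
Require Import Defs.
From HB Require Import structures.
From mathcomp Require Import all_boot all_order all_algebra.
From mathcomp Require Import boolp classical_sets functions reals topology.
From mathcomp Require Import normedtype homotopy.

Import numFieldNormedType.Exports.

(** The statement is the universal property of the quotient by a normal closure,
    and holds for an element [m] and a subgroup [U] of any group, over any
    field. A class [a] in H^1(H; F) is a homomorphism to an abelian group, so its
    kernel is a normal subgroup; hence [a] kills a set [A] if and only if it
    kills the normal closure of [A] ([H1_normal_closure]). It factors through
    the quotient by a normal subgroup [N] exactly when it kills [N]
    ([inflation_image]), and uniquely so because the projection is surjective
    ([inflation_inj]). With [A] the union of the inertia subgroups, killing [A]
    is being unramified, one inertia subgroup at a time. *)

Section CharacterKernel.
Context {H : groupType} {F : fieldType}.
Implicit Types a : H1 H F.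

Lemma H1_1 a : a 1%g = 0%R.
Proof. by apply: (@GRing.addrI _ (a 1%g)); rewrite -H1M mulg1 GRing.addr0. Qed.

Lemma H1_V a x : a x^-1%g = (- a x)%R.
Proof. by apply: (@GRing.addrI _ (a x)); rewrite -H1M mulgV H1_1 GRing.subrr. Qed.

Definition H1_kernel a : {pred H} := fun x => a x == 0%R.

Lemma H1_kernelE a x : (x \in H1_kernel a) = (a x == 0%R).
Proof. by []. Qed.

Context (a : H1 H F).

Fact H1_kernel1 : 1%g \in H1_kernel a.
Proof. by rewrite H1_kernelE H1_1. Qed.

Fact H1_kernelM : mulg_closed (H1_kernel a).
Proof.
by move=> x y; rewrite !H1_kernelE H1M => /eqP -> /eqP ->; rewrite GRing.addr0.
Qed.

Fact H1_kernelV : invg_closed (H1_kernel a).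
Proof. by move=> x; rewrite !H1_kernelE H1_V GRing.oppr_eq0. Qed.

(** Commutativity of the target makes [a] constant on conjugacy classes. *)
Fact H1_kernel_conj (x y : H) :
  x \in H1_kernel a -> (x ^ y)%g \in H1_kernel a.
Proof.
rewrite !H1_kernelE /conjg !H1M H1_V => /eqP ->.
by rewrite GRing.add0r GRing.addNr.
Qed.

HB.instance Definition _ := isMulClosed.Build H (H1_kernel a) H1_kernelM.
HB.instance Definition _ := isMul1Closed.Build H (H1_kernel a) H1_kernel1.
HB.instance Definition _ := isInvClosed.Build H (H1_kernel a) H1_kernelV.
HB.instance Definition _ := isConjClosed.Build H (H1_kernel a) H1_kernel_conj.

(** The normal closure is an intersection of normal subgroups, and the kernel of
    [a] is one of them as soon as [a] kills [A]. *)
Lemma H1_normal_closure (A : set H) :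
  (forall x, x \in normal_closure A -> a x = 0%R) <-> (forall x, A x -> a x = 0%R).
Proof.
split=> aA x Ax.
  by apply: aA; apply/normal_closureP => N; exact.
apply/eqP; rewrite -H1_kernelE.
by move/normal_closureP: Ax; apply=> y Ay; apply/eqP/aA.
Qed.

End CharacterKernel.

Section Inflation.
Context {F : fieldType} {H : groupType} (N : normalClosed H).
Implicit Types (a : H1 H F) (b : H1 (quotient_group N) F).

Lemma inflation_linear : linear (inflation F N).
Proof. by move=> k b c; apply: val_inj. Qed.

Lemma inflation_inj : injective (inflation F N).
Proof.
move=> b c bc; apply/val_inj/funext; elim/quotient_ind => x.
exact: (congr1 (fun a : H1 H F => a x) bc).
Qed.

(** If [a] kills [N], it is constant on the cosets of [N], so that its values on
    coset representatives define [b]. *)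
Lemma inflation_image a :
  (exists b, forall x, a x = b (coset N x)) <->
  (forall x, x \in N -> a x = 0%R).
Proof.
split=> [[b ab] x Nx|aN].
  have -> : a x = b 1%g; last exact: H1_1.
  rewrite ab; congr (H1_fun b _).
  by apply/cosetP; rewrite mulg1 gpredV.
pose f (q : quotient_group N) : F^o := a (repr q).
have fE x : f (coset N x) = a x.
  apply/esym/(@GRing.addrI _ (- a x)%R); rewrite GRing.addNr -H1_V -H1M.
  by apply/esym/aN; exact: coset_repr.
have f_char : f \in @add_char (quotient_group N) F.
  apply/asboolP; elim/quotient_ind => x; elim/quotient_ind => y.
  by rewrite -gmulfM !fE H1M.
by exists (exist _ f f_char) => x; rewrite -fE.
Qed.

End Inflation.

Section Unramified.
Context {F : fieldType} {G : groupType} {m : G} {U : groupClosed G}.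
Implicit Types a : H1 (subgroup U) F.

Lemma unramifiedP a :
  unramified m a <-> forall g u, u \in inertia m U g -> a u = 0%R.
Proof.
split=> [am g u gu|am g].
  exact: (congr1 (fun c : H1 (subgroup (inertia m U g)) F => c (Sub u gu))
                 (am g)).
by apply/val_inj/funext => u; apply: (am g); exact: valP u.
Qed.

Lemma factors_through_ramificationP a :
  (exists b : H1 (quotient_group (ramification_subgroup m U)) F,
     forall u, a u = b (coset (ramification_subgroup m U) u)) <->
  (forall g u, u \in inertia m U g -> a u = 0%R).
Proof.
rewrite inflation_image H1_normal_closure; split=> am.
  by move=> g u gu; apply: am; exists g.
by move=> u [g _ gu]; exact: am gu.
Qed.

Lemma inflation_unramified_bij :
  set_bij [set: H1 (quotient_group (ramification_subgroup m U)) F]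
          [set a : H1 (subgroup U) F | unramified m a]
          (inflation F (ramification_subgroup m U)).
Proof.
split=> [b _|b c _ _|a /= /unramifiedP/factors_through_ramificationP[b ab]].
- by apply/unramifiedP/factors_through_ramificationP; exists b.
- exact: inflation_inj.
- by exists b => //; apply/val_inj/funext => u; exact/esym/ab.
Qed.

End Unramified.

Theorem theorem3p5 (R : realType) (K N : set (sphere R 3))
  (K_tame : tame_knot K) (K_nontrivial : ~ trivial_knot K)
  (N_tubular : tubular_neighbourhood K N)
  (x0 : exterior_boundary N)
  (mu : pi1 R x0) (mu_meridian : meridian K mu)
  (m : knot_group x0) (m_def : m = peripheral_map mu)
  (U : groupClosed (knot_group x0)) (U_finite_index : finite_index U)
  (p : nat) (p_prime : prime p) :
  let M_U := ramification_subgroup m U in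
  [/\ linear (inflation 'F_p M_U),
      set_bij [set: H1 (quotient_group M_U) 'F_p]
              [set a : H1 (subgroup U) 'F_p | unramified m a]
              (inflation 'F_p M_U) &
      forall a : H1 (subgroup U) 'F_p,
        (exists b : H1 (quotient_group M_U) 'F_p,
           forall u : subgroup U, a u = b (coset M_U u)) <->
        (forall (g : knot_group x0) (u : subgroup U),
           u \in inertia m U g -> a u = 0%R)].
Proof.
split; first exact: inflation_linear.
- exact: inflation_unramified_bij.
- exact: factors_through_ramificationP.
Qed.
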